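(* Let $G$ be a countable abelian group and suppose $A,B\subset G$ satisfy $$d_*(AB)\le K\cdot d_*(B)$$ for some $K$. Then $$d^*(A^k)\le K^k\cdot d^*(B)\qquad\text{for all } k\ge1.$$ In particular, for every integer $k\ge 1$, we have $$d_*(AB)\ge d^*(A^k)^{\frac1k}\cdot d_*(B)^{1-\frac1k}$$ for all $A,B\subset G$.
   Context: For $A,B\subset G$, $AB=\{ab: a\in A, b\in B\}$, and $A^k$ is the $k$-fold product set of $A$ with itself. A mean on $G$ is a positive norm-one linear functional on $\ell^\infty(G)$; for a mean $\lambda$ put $\lambda'(C)=\lambda(\chi_C)$, $C\subset G$, where $\chi_C$ is the indicator function of $C$. $\mathcal{L}_G$ is the set of all translation-invariant means on $G$. The upper and lower Banach densities of $C\subset G$ are $d^*(C)=\sup_{\lambda\in\mathcal{L}_G}\lambda'(C)$ and $d_*(C)=\inf_{\lambda\in\mathcal{L}_G}\lambda'(C)$.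
   Formalization: The first claim is stated under the extra assumption d_*(B)>0 (it fails for A=B=N in Z, K=1/2); in the second claim d_*(B)>0 is assumed only when k=1, where the right side would otherwise involve 0^0. *)

(* Defs.v *)
From HB Require Import structures.
From mathcomp Require Import all_boot all_order all_algebra.
From mathcomp Require Import all_classical all_reals all_analysis.

Set Implicit Arguments.
Unset Strict Implicit.
Unset Printing Implicit Defensive.
Import Order.TTheory GRing.Theory Num.Theory.
Import numFieldNormedType.Exports.
Local Open Scope classical_set_scope.
Local Open Scope ring_scope.

(* Abelian groups are written additively (zmodType): the product set AB is the
   sumset, and A^k is the k-fold sumset; means act on real-valued bounded
   functions. *)

Section Linf.
Context (R : realType) (G : Type).

Definition linf_pred : {pred G -> R} :=
  mem [set f : G -> R | bounded_fun (f : G -> R^o)].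

Lemma linf_predP (f : G -> R) :
  reflect (exists M, forall x, `|f x| <= M) (f \in linf_pred).
Proof.
apply: (iffP idP) => [|[M fM]]; rewrite inE /=.
  case=> M [_ /(_ (M + 1))]; rewrite ltrDl ltr01 => /(_ isT) fM.
  by exists (M + 1) => x; exact: fM.
by exists M; split; rewrite ?num_real// => N /ltW MN x _; exact: le_trans (fM x) MN.
Qed.

Lemma linf_submod_closed : submod_closed linf_pred.
Proof.
split; first by apply/linf_predP; exists 0 => x; rewrite normr0.
move=> a f g /linf_predP[M fM] /linf_predP[N gN].
apply/linf_predP; exists (`|a| * M + N) => x.
by rewrite (le_trans (ler_normD _ _))// lerD// normrM ler_wpM2l.
Qed.

HB.instance Definition _ :=
  GRing.isSubmodClosed.Build R (G -> R) linf_pred linf_submod_closed.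

Record linf := Linf { linf_val :> G -> R ; linf_valP : linf_val \in linf_pred }.

HB.instance Definition _ := [isSub for linf_val].
HB.instance Definition _ := [Choice of linf by <:].
HB.instance Definition _ := [SubChoice_isSubLmodule of linf by <:].

Definition linf_norm (f : linf) : R := sup (range (fun x => `|f x|)).

(* The real supremum of an unbounded set is 0, so [dual_norm L = 1] entails
   that L is a bounded functional. *)
Definition dual_norm (L : linf -> R) : R :=
  sup [set `|L f| | f in [set f | linf_norm f <= 1]].

Lemma indic_linf (C : set G) : (\1_C : G -> R) \in linf_pred.
Proof.
apply/linf_predP; exists 1 => x.
by rewrite indicE; case: (_ \in _); rewrite ?normr1 ?normr0.
Qed.

Definition linf_indic (C : set G) : linf := Linf (indic_linf C).

Definition is_mean (L : {linear linf -> R^o}) : Prop :=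
  (forall f : linf, (forall x, 0 <= f x) -> 0 <= L f) /\ dual_norm L = 1.

Definition mean_set (L : {linear linf -> R^o}) (C : set G) : R := L (linf_indic C).

End Linf.

Section BanachDensity.
Context (R : realType) (G : zmodType).

Lemma translate_linf (g : G) (f : linf R G) :
  (fun x => f (g + x)) \in @linf_pred R G.
Proof. by have /linf_predP[M fM] := linf_valP f; apply/linf_predP; exists M => x. Qed.

Definition translate (g : G) (f : linf R G) : linf R G := Linf (translate_linf g f).

Definition invariant_means : set {linear linf R G -> R^o} :=
  [set L | is_mean L /\ forall g f, L (translate g f) = L f].

(* [sup] and [inf] are taken in R: the values lie in [0, 1], and the set of
   invariant means is nonempty because abelian groups are amenable. *)
Definition upper_density (C : set G) : R :=
  sup [set mean_set L C | L in invariant_means].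

Definition lower_density (C : set G) : R :=
  inf [set mean_set L C | L in invariant_means].

End BanachDensity.

Definition sumset (G : zmodType) (A B : set G) : set G :=
  [set a + b | a in A & b in B].

Definition iter_sumset (G : zmodType) (A : set G) (k : nat) : set G :=
  iterop k (@sumset G) A [set 0].

(* Main.v *)
From HB Require Import structures.
Require Import Defs.
From mathcomp Require Import all_boot all_order all_algebra.
From mathcomp Require Import all_classical all_reals all_analysis.
From mathcomp Require Import ring lra.
Import Order.TTheory GRing.Theory Num.Theory.
Import numFieldNormedType.Exports.
Local Open Scope classical_set_scope.
Local Open Scope ring_scope.
Set Implicit Arguments.
Unset Strict Implicit.
Unset Printing Implicit Defensive.

(** Write S for the sumset A + B, delta for its lower density, beta > 0 for the
lower density of B, and alpha for the measure of the k-fold sumset kA under some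
invariant mean.  Both halves of the theorem follow from the single inequality
alpha * beta ^ (k - 1) <= delta ^ k, proved here by transporting Petridis' proof
of Pluennecke's inequality to invariant means.

Fix an invariant mean L and kappa > 0.  If Z, contained in B, minimizes
Z |-> L (A + Z) - kappa * L Z among the subsets of B, then Petridis' argument
gives L (A + C + Z) <= kappa * L (C + Z) for every finite C, hence
L (D + Z) <= kappa ^ k * L Z for every finite subset D of kA ([petridis],
[petridis_iter]).  In the other direction, a Foelner argument
([thick_finite_subset]) shows that for every finite F there is a finite subset D
of kA such that L (D + Z) >= (alpha - e) * L (F + Z) for all L and Z at once.  So
if L (F + Z) is almost 1 for some finite F, then alpha <= kappa ^ k * L B, up to
an error.

Two obstacles remain.  First, a finitely additive measure need not admit
minimizers, and an almost minimizer costs an error proportional to the size of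
C, while F, hence D, depends on Z.  Since Z |-> L (A + Z) - kappa * L Z is
submodular, breaking ties by a large L Z makes the almost minimizers a Cauchy
family for the distance L (X \ Y) ([cauchy_minimizers]), so that one F serves
all sufficiently good minimizers ([saturation]).  Secondly, if L is a mixture of
several means, Z may live on only one of them, and then L (F + Z) stays away from
1.  This is excluded by optimizing over the pair (L, Z): the set E = F + Z
splits L into L E times an invariant mean plus 1 - L E times another one for
which Z is almost null ([mean_split]).  The second mean contributes almost
nothing to a functional whose infimum is strictly negative, so near the infimum
1 - L E must be small ([plunnecke_mean]).

The functional optimized over (L, Z) carries a penalty M * (L S - delta), which
keeps L S close to delta.  Let b be the supremum of the values L B over the means
with L S <= delta + e, in the limit e -> 0.  With kappa close to delta / b and M
large, the conclusion reads alpha <= (delta / b) ^ k * b, and b >= beta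
([plunnecke_density]). *)

(** * Sumsets *)

Section SumsetTheory.
Context {G : zmodType}.
Implicit Types (A B X Y Z : set G) (C D : seq G) (g : G).

Definition translate_set g X : set G := [set x | X (x - g)].

Lemma sumsetS A B X Y : A `<=` B -> X `<=` Y -> sumset A X `<=` sumset B Y.
Proof.
by move=> AB XY _ [a Aa [x Xx <-]]; exists a; [exact: AB | exists x => //; exact: XY].
Qed.

Lemma sumsetUr A X Y : sumset A (X `|` Y) = sumset A X `|` sumset A Y.
Proof.
apply/seteqP; split=> x.
  by case=> a Aa [y [Xy|Yy] <-]; [left | right]; exists a => //; exists y.
by case=> -[a Aa [y Xy <-]]; exists a => //; exists y => //; [left | right].
Qed.

Lemma sumsetA A B X : sumset (sumset A B) X = sumset A (sumset B X).
Proof.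
apply/seteqP; split=> x.
  case=> _ [a Aa [b Bb <-]] [y Xy <-].
  by exists a => //; exists (b + y); [exists b => //; exists y | rewrite addrA].
case=> a Aa [_ [b Bb [y Xy <-]] <-].
by exists (a + b); [exists a => //; exists b | exists y => //; rewrite addrA].
Qed.

Lemma sumsetC A B : sumset A B = sumset B A.
Proof.
by apply/seteqP; split=> x [a Aa [b Bb <-]]; exists b => //; exists a => //; exact: addrC.
Qed.

Lemma sumset_nil X : sumset [set` [::]] X = set0.
Proof. by apply/seteqP; split=> // x [a]. Qed.

Lemma sumset_cons g C X :
  sumset [set` g :: C] X = translate_set g X `|` sumset [set` C] X.
Proof.
apply/seteqP; split=> x.
  case=> c /=; rewrite inE => /orP[/eqP -> [y Xy <-]|cC [y Xy <-]].
    by left; rewrite /translate_set/= addrC addKr.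
  by right; exists c => //; exists y.
case=> [Xx|[c /= cC Xx]].
  by exists g; [rewrite /= mem_head | exists (x - g) => //; rewrite addrCA subrr addr0].
by exists c => //=; rewrite inE cC orbT.
Qed.

(** Finite sets are lists, so that the errors below can be counted by their
size; repetitions only enlarge the count. *)
Fixpoint seq_sums (C : seq G) k : seq G :=
  if k is k'.+1 then [seq a + c | a <- C, c <- seq_sums C k'] else [:: 0].

Lemma sumset_seqs C k X :
  sumset [set` seq_sums C k.+1] X = sumset [set` C] (sumset [set` seq_sums C k] X).
Proof.
rewrite -sumsetA; congr (sumset _ X); apply/seteqP; split=> x.
  by move=> /allpairsP[[a c] /= [aC cC ->]]; exists a => //; exists c.
by case=> a aC [c cC <-]; apply/allpairsP; exists (a, c).
Qed.

Lemma iter_sumsetS A k :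
  iter_sumset A k.+2 = sumset A (iter_sumset A k.+1).
Proof. by []. Qed.

(** Each element of the k-fold sumset uses only k elements of A, so a finite part
of it only sees a finite part of A. *)
Lemma seq_in_iter_sumset A k (D : seq G) : (0 < k)%N ->
  [set` D] `<=` iter_sumset A k ->
  exists C : seq G, [set` C] `<=` A /\ [set` D] `<=` [set` seq_sums C k].
Proof.
move=> k0.
have mono C C' j : [set` C] `<=` [set` C'] -> [set` seq_sums C j] `<=` [set` seq_sums C' j].
  move=> CC'; elim: j => // j IH _ /allpairsP[[a c] /= [aC cC ->]].
  by apply/allpairsP; exists (a, c); split=> //; [exact: CC' | exact: IH].
have one d : iter_sumset A k d -> exists C : seq G,
    [set` C] `<=` A /\ [set` seq_sums C k] d.
  case: k k0 => // k _; elim: k d => [|k IH] d.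
    move=> Ad; exists [:: d]; split; first by move=> x /=; rewrite inE => /eqP ->.
    by rewrite /= inE addr0.
  rewrite iter_sumsetS => -[a Aa [c /IH[C [CA Cc]] <-]].
  exists (a :: C); split; first by move=> x /=; rewrite inE => /orP[/eqP->|/CA].
  have CaC : [set` C] `<=` [set` a :: C] by move=> x /= xC; rewrite inE xC orbT.
  apply/allpairsP; exists (a, c); split => //; first exact: mem_head.
  exact: (mono _ _ k.+1 CaC c Cc).
elim: D => [|d D IH] DA; first by exists [::]; split.
have [|C [CA DC]] := IH; first by move=> x /= xD; apply: DA; rewrite /= inE xD orbT.
have [|C' [CA' DC']] := one d; first by apply: DA; exact: mem_head.
exists (C ++ C'); split.
  by move=> x /=; rewrite mem_cat => /orP[/CA|/CA'].
move=> x /=; rewrite inE => /orP[/eqP ->|/DC].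
  apply: (mono C' _ k _ d DC') => y /= yC.
  by rewrite mem_cat yC orbT.
by apply: (mono C _ k) => y /= yC; rewrite mem_cat yC.
Qed.

End SumsetTheory.

(** * Positive functionals on bounded functions *)

Section Functionals.
Context {R : realType} {G : zmodType}.
Implicit Types (L : {linear linf R G -> R^o}) (f : linf R G) (X Y : set G).

Definition positive_functional (L : linf R G -> R) :=
  forall f, (forall x, 0 <= f x) -> 0 <= L f.

Lemma linf_ext f f' : f =1 f' -> f = f'.
Proof. by move=> ff'; apply/val_inj/funext. Qed.

Lemma linfD f f' x : (f + f') x = f x + f' x. Proof. by []. Qed.
Lemma linfB f f' x : (f - f') x = f x - f' x. Proof. by []. Qed.
Lemma linfZ (a : R) f x : (a *: f) x = a * f x. Proof. by []. Qed.
Lemma linf_sum (I : Type) (r : seq I) (F : I -> linf R G) x :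
  (\sum_(i <- r) F i) x = \sum_(i <- r) F i x.
Proof. by elim/big_rec2: _ => // i y1 y2 _ <-. Qed.

Lemma linf_indicE X x : linf_indic R X x = (x \in X)%:R.
Proof. by rewrite /= indicE. Qed.

Lemma functional_le {L} : positive_functional L ->
  forall f f', (forall x, f x <= f' x) -> L f <= L f'.
Proof.
by move=> L0 f f' ff'; rewrite -subr_ge0 -linearB L0// => x; rewrite linfB subr_ge0.
Qed.

Lemma mean_set_setT f c L : (forall x, f x = c) -> L f = c * mean_set L setT.
Proof.
move=> fc; rewrite /mean_set -[RHS]/(c *: (_ : R^o)) -linearZ; congr (L _).
by apply: linf_ext => x; rewrite linfZ linf_indicE in_setT mulr1.
Qed.

Lemma linf_bounded f : exists2 M, 0 <= M & forall x, `|f x| <= M.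
Proof.
have /linf_predP[M fM] := linf_valP f; exists M => //.
exact: le_trans (normr_ge0 _) (fM 0).
Qed.

Lemma linf_norm_ub f x : `|f x| <= linf_norm f.
Proof.
apply: sup_ubound; last by exists x.
by have [M _ fM] := linf_bounded f; exists M => _ [y _ <-].
Qed.

(** Positivity gives |L f| <= L 1 on the unit ball, with equality at the constant
function 1; this turns the norm condition on means into L 1 = 1. *)
Lemma dual_norm_positive L : positive_functional L -> dual_norm L = mean_set L setT.
Proof.
move=> L0.
have T0 : 0 <= mean_set L setT by apply: L0 => x; rewrite linf_indicE.
have ubT : ubound [set `|L f| | f in [set f | linf_norm f <= 1]] (mean_set L setT).
  move=> _ [f /= f1 <-]; rewrite ler_norml; apply/andP; split.
    rewrite lerNl -linearN; apply: functional_le => // x.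
    rewrite linf_indicE in_setT; apply: le_trans f1.
    by apply: le_trans (linf_norm_ub _ x); rewrite -normrN ler_norm.
  apply: functional_le => // x.
  rewrite linf_indicE in_setT (le_trans (ler_norm _))//.
  exact: le_trans (linf_norm_ub _ x) f1.
apply/eqP; rewrite eq_le; apply/andP; split.
  apply: ge_sup ubT; exists `|L 0|, 0 => //=.
  apply: ge_sup => [|_ [x _ <-]]; last by rewrite normr0.
  by exists `|(0 : linf R G) 0|, 0.
apply: sup_ubound; first by exists (mean_set L setT).
exists (linf_indic R setT); last by rewrite ger0_norm.
apply: ge_sup => [|_ [x _ <-]]; first by exists `|linf_indic R [set: G] 0|, 0.
by rewrite linf_indicE in_setT normr1.
Qed.

Lemma mean_positive {L} : invariant_means L -> positive_functional L.
Proof. by case=> -[]. Qed.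

Lemma mean_translate {L} : invariant_means L -> forall g f, L (translate g f) = L f.
Proof. by case. Qed.

Lemma meanT {L} : invariant_means L -> mean_set L setT = 1.
Proof. by move=> Li; rewrite -dual_norm_positive; [case: Li => -[] | exact: mean_positive]. Qed.

Lemma invariant_meanP L : positive_functional L -> mean_set L setT = 1 ->
  (forall g f, L (translate g f) = L f) -> invariant_means L.
Proof. by move=> L0 L1 Lt; split=> //; split=> //; rewrite dual_norm_positive. Qed.

End Functionals.

(** * Invariant means as finitely additive set functions *)

Section MeanSet.
Context {R : realType} {G : zmodType} {L : {linear linf R G -> R^o}}.
Hypothesis L_inv : invariant_means L.
Local Notation mu := (mean_set L).
Implicit Types (X Y Z A B E : set G) (C D : seq G) (g : G).

Lemma mean_le X Y : X `<=` Y -> mu X <= mu Y.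
Proof.
move=> XY; apply: functional_le; first exact: mean_positive.
move=> x; rewrite !linf_indicE ler_nat.
by case: (boolP (x \in X)) => // /set_mem/XY/mem_set ->.
Qed.

Lemma mean_ge0 X : 0 <= mu X.
Proof. by apply: mean_positive => // x; rewrite linf_indicE. Qed.

Lemma mean_le1 X : mu X <= 1.
Proof. by rewrite -(meanT L_inv); exact: mean_le. Qed.

Lemma mean0 : mu set0 = 0.
Proof.
rewrite /mean_set (_ : linf_indic R set0 = 0) ?linear0//.
by apply: linf_ext => x; rewrite linf_indicE in_set0.
Qed.

Lemma mean_splitE X E : mu X = mu (X `&` E) + mu (X `\` E).
Proof.
rewrite /mean_set -linearD; congr (L _); apply: linf_ext => x.
rewrite linfD !linf_indicE in_setI in_setD.
by case: (x \in X); case: (x \in E); rewrite /= ?addr0 ?add0r.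
Qed.

Lemma meanUI X Y : mu (X `|` Y) + mu (X `&` Y) = mu X + mu Y.
Proof.
rewrite /mean_set -!linearD; congr (L _); apply: linf_ext => x.
rewrite !linfD !linf_indicE in_setI in_setU.
by case: (x \in X); case: (x \in Y); rewrite /= ?addr0 ?add0r.
Qed.

Lemma meanD X Y : Y `<=` X -> mu (X `\` Y) = mu X - mu Y.
Proof.
move=> YX; rewrite (mean_splitE X Y); have -> : X `&` Y = Y by apply/setIidPr.
by rewrite addrAC subrr add0r.
Qed.

Lemma meanU_le X Y : mu (X `|` Y) <= mu X + mu Y.
Proof. by rewrite -meanUI lerDl mean_ge0. Qed.

Lemma mean_translate_set g X : mu (translate_set g X) = mu X.
Proof.
rewrite /mean_set -[RHS](mean_translate L_inv (- g)); congr (L _).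
apply: linf_ext => x; rewrite linf_indicE /= indicE; congr (nat_of_bool _)%:R.
by apply/idP/idP => /set_mem /=; rewrite /translate_set/= => ?; apply/mem_set; rewrite /= addrC.
Qed.

Lemma mean_sumset_seq C X : mu (sumset [set` C] X) <= (size C)%:R * mu X.
Proof.
elim: C => [|c C IH]; first by rewrite sumset_nil mean0 mul0r.
rewrite sumset_cons (le_trans (meanU_le _ _))//= mean_translate_set -addn1 natrD mulrDl mul1r.
by rewrite addrC lerD2r.
Qed.

Lemma mean_sumset_seq_diff C X Y :
  mu (sumset [set` C] X) <= mu (sumset [set` C] Y) + (size C)%:R * mu (X `\` Y).
Proof.
have XY : X `<=` Y `|` (X `\` Y).
  by move=> x Xx; case: (pselect (Y x)) => ?; [left | right].
apply: le_trans (mean_le (sumsetS (@subset_refl _ _) XY)) _.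
rewrite sumsetUr (le_trans (meanU_le _ _))// lerD2l; exact: mean_sumset_seq.
Qed.

End MeanSet.

(** * Petridis' inequality for almost minimizers *)

Section Petridis.
Context {R : realType} {G : zmodType} {L : {linear linf R G -> R^o}}.
Hypothesis L_inv : invariant_means L.
Local Notation mu := (mean_set L).
Implicit Types (X Y Z A B E : set G) (C D : seq G) (g : G).

Lemma sumset_translate A g X : sumset A (translate_set g X) = translate_set g (sumset A X).
Proof.
apply/seteqP; split=> x; rewrite /translate_set/=.
  by case=> a Aa [y Xy <-]; exists a => //; exists (y - g) => //; rewrite addrA.
by case=> a Aa [y Xy e]; exists a => //; exists (y + g); rewrite /= ?addrK// addrA e subrK.
Qed.

(** The bound is only required over the subsets of Z itself: this is all that
Petridis' induction uses. *)
Definition almost_minimizer A (kappa eta : R) Z :=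
  forall Z', Z' `<=` Z ->
    mu (sumset A Z) - kappa * mu Z <= mu (sumset A Z') - kappa * mu Z' + eta.

(** Induction on C.  Adding c to C enlarges C + Z by the translate by c of Z minus
Z', where Z' collects the points of Z whose translate already lies in C + Z.  It
enlarges A + C + Z by at most a translate of (A + Z) minus (A + Z'), which
minimality bounds by kappa * L (Z minus Z') + eta. *)
Lemma petridis A kappa eta Z C : almost_minimizer A kappa eta Z ->
  mu (sumset A (sumset [set` C] Z))
    <= kappa * mu (sumset [set` C] Z) + (size C)%:R * eta.
Proof.
move=> hZ; elim: C => [|c C IH].
  rewrite sumset_nil mean0 mulr0 mul0r addr0.
  by rewrite sumsetC (_ : sumset _ _ = set0) ?mean0//; apply/seteqP; split=> // x [].
set W := sumset [set` C] Z in IH *.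
pose Z' := Z `&` [set z | W (z + c)].
have Z'Z : Z' `<=` Z by exact: subIsetl.
have WZ' : translate_set c Z `&` W = translate_set c Z'.
  by apply/seteqP; split=> x; rewrite /translate_set /Z' /= subrK.
rewrite sumset_cons sumsetUr -/W.
have e1 := meanUI (L := L) (translate_set c Z) W.
have e2 := meanUI (L := L) (sumset A (translate_set c Z)) (sumset A W).
have e3 : mu (sumset A Z') <= mu (sumset A (translate_set c Z) `&` sumset A W).
  rewrite -(mean_translate_set L_inv c) -sumset_translate; apply: (mean_le L_inv).
  rewrite subsetI; split; apply: sumsetS => //; rewrite -WZ'.
    exact: subIsetl.
  exact: subIsetr.
rewrite WZ' !(mean_translate_set L_inv) in e1.
rewrite (sumset_translate A c Z) (mean_translate_set L_inv) -sumset_translate in e2.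
have -> : mu (translate_set c Z `|` W) = mu Z + mu W - mu Z' by rewrite -e1 addrK.
have e4 := hZ _ Z'Z.
rewrite /= -addn1 natrD; lra.
Qed.

(** The order of the quantifiers matters: N is known before the quality eta of the
almost minimizer Z is chosen, so that N * eta can be made small. *)
Lemma petridis_iter A C kappa k : 0 <= kappa -> [set` C] `<=` A ->
  exists N, forall Z eta, almost_minimizer A kappa eta Z ->
    mu (sumset [set` seq_sums C k] Z) <= kappa ^+ k * mu Z + N * eta.
Proof.
move=> kappa0 CA; elim: k => [|k [N IH]].
  exists 0 => Z eta _; rewrite expr0 mul1r mul0r addr0; apply: (mean_le L_inv).
  by move=> x [a /=]; rewrite inE => /eqP -> [y Zy <-]; rewrite add0r.
exists (kappa * N + (size (seq_sums C k))%:R) => Z eta hZ.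
rewrite sumset_seqs.
apply: le_trans (mean_le L_inv (sumsetS CA (@subset_refl _ _))) _.
apply: le_trans (petridis _ hZ) _.
have := ler_wpM2l kappa0 (IH _ _ hZ); rewrite exprS; lra.
Qed.

End Petridis.

(** * Finite subsets as thick as an infinite set *)

Section Thickness.
Context {R : realType} {G : zmodType}.
Implicit Types (X Y Z P : set G) (D H T : seq G) (g h x y : G).

Lemma sumr_const_seq (V : nmodType) (I : Type) (r : seq I) (a : V) :
  \sum_(i <- r) a = a *+ size r.
Proof. by rewrite big_const_seq count_predT iter_addr_0. Qed.

(** Averages over T are almost invariant under H, where T is a long box
{n1 h1 + ... + nr hr : ni < N}, listed with multiplicity to accommodate relations
between the hi. *)
Lemma folner_sequence H (e : R) : 0 < e ->
  exists2 T, (0 < size T)%N & forall h, h \in H ->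
    forall (c : R) (f : G -> R), (forall x, 0 <= f x <= c) -> forall x,
    `|\sum_(t <- T) f (t + (h + x)) - \sum_(t <- T) f (t + x)| <= e * (size T)%:R * c.
Proof.
move=> e0; elim: H => [|h H [T T0 IH]]; first by exists [:: 0].
have [N N0 Ne] : exists2 N, (0 < N)%N & 1 <= e * N%:R.
  have eb : e^-1 < (Num.bound e^-1)%:R by apply: archi_boundP; rewrite invr_ge0 ltW.
  exists (Num.bound e^-1); first by rewrite -(ltr_nat R) (lt_trans _ eb)// invr_gt0.
  by rewrite -ler_pdivrMl// mulr1 ltW.
exists [seq t + h *+ n | t <- T, n <- iota 0 N].
  by rewrite size_allpairs size_iota muln_gt0 T0.
move=> h' hH c f fc x.
have f0 z : 0 <= f z by have /andP[] := fc z.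
have f1 z : f z <= c by have /andP[] := fc z.
have c0 : 0 <= c by exact: le_trans (f0 0) (f1 0).
rewrite size_allpairs size_iota !big_allpairs_dep/=.
move: hH; rewrite inE => /orP[/eqP -> | hH]; last first.
  (* Directions of H see the average of f along h, which is bounded by N c. *)
  pose F y := \sum_(n <- iota 0 N) f (y + h *+ n).
  have Fc y : 0 <= F y <= N%:R * c.
    rewrite sumr_ge0//= /F -[N in N%:R](size_iota 0).
    rewrite mulr_natl -sumr_const_seq; exact: ler_sum.
  have FE y : \sum_(t <- T) \sum_(n <- iota 0 N) f (t + h *+ n + y)
      = \sum_(t <- T) F (t + y).
    by do 2!(apply: eq_bigr => ? _); rewrite addrAC.
  rewrite !FE (_ : e * _ * c = e * (size T)%:R * (N%:R * c)); first exact: IH.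
  by rewrite natrM !mulrA.
rewrite -sumrB (le_trans (ler_norm_sum _ _ _))//.
(* In the direction h itself the sum telescopes to two boundary terms. *)
have tele t : `|\sum_(n <- iota 0 N) f (t + h *+ n + (h + x))
             - \sum_(n <- iota 0 N) f (t + h *+ n + x)| <= c.
  rewrite -sumrB (eq_bigr (fun n => f (t + h *+ n.+1 + x) - f (t + h *+ n + x))).
    rewrite -[N in iota 0 N]subn0 -/(index_iota 0 N) telescope_sumr//.
    rewrite ler_norml; have := f0 (t + h *+ N + x); have := f1 (t + h *+ N + x).
    have := f0 (t + h *+ 0 + x); have := f1 (t + h *+ 0 + x); lra.
  by move=> n _; rewrite mulrSr -!addrA.
apply: le_trans (ler_sum _ (fun t _ => tele t)) _.
rewrite sumr_const_seq -[leLHS]mulr_natl natrM ler_wpM2r//.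
by rewrite mulrCA ler_peMr.
Qed.

(** Averages over a box T have the same m-mean as P, so some translate T + y
meets P in proportion at least m P - e / 2; as T is almost H-invariant, so do all
the T + h + y up to e / 2.  For x = h + z in H + Z, the average of D + Z over
T + y + x dominates that of D over T + y + h.  The choice of D involves neither
Z nor the mean L. *)
Lemma thick_finite_subset (m : {linear linf R G -> R^o}) P H (e : R) :
  invariant_means m -> 0 < e ->
  exists D, [set` D] `<=` P /\
    forall L : {linear linf R G -> R^o}, invariant_means L -> forall Z,
      (mean_set m P - e) * mean_set L (sumset [set` H] Z)
        <= mean_set L (sumset [set` D] Z).
Proof.
move=> m_inv e0; set alpha := mean_set m P.
have [T T0 hT] := folner_sequence H (divr_gt0 e0 (ltr0n R 2)).
have n0 : 0 < (size T)%:R :> R by rewrite ltr0n.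
have [y hy] : exists y, (alpha - e / 2) * (size T)%:R
    <= \sum_(t <- T) (t + y \in P)%:R.
  apply: contrapT => /forallNP hy.
  have : m (\sum_(t <- T) translate t (linf_indic R P))
         <= (alpha - e / 2) * (size T)%:R * mean_set m setT.
    rewrite -[leRHS]/(_ *: (_ : R^o)) -linearZ.
    apply: (functional_le (mean_positive m_inv)) => x.
    rewrite linf_sum linfZ linf_indicE in_setT mulr1 ltW// ltNge; apply/negP.
    by have := hy x; under eq_bigr do rewrite -linf_indicE.
  rewrite linear_sum (eq_bigr (fun=> alpha)); last first.
    by move=> t _; rewrite (mean_translate m_inv).
  rewrite sumr_const_seq -[leLHS]mulr_natl (meanT m_inv) mulr1 mulrC ler_pM2r//; lra.
exists [seq x <- [seq t + (h + y) | t <- T, h <- H] | x \in P].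
set D := [seq _ <- _ | _]; split.
  by move=> x /=; rewrite mem_filter => /andP[/set_mem].
move=> L L_inv Z; set E := sumset _ Z; set F := sumset _ Z.
rewrite -(ler_pM2l n0) mulrA -[leLHS]/(_ *: (_ : R^o)) -linearZ.
have -> : (size T)%:R * mean_set L F
    = L (\sum_(t <- T) translate (t + y) (linf_indic R F)).
  rewrite linear_sum (eq_bigr (fun=> mean_set L F)); last first.
    by move=> t _; rewrite (mean_translate L_inv).
  by rewrite sumr_const_seq mulr_natl.
apply: (functional_le (mean_positive L_inv)) => x.
rewrite linfZ linf_sum linf_indicE.
case: (boolP (x \in E)) => [/set_mem[h /= hH [z Zz <-]]|_]; last first.
  by rewrite mulr0; apply: sumr_ge0 => t _; rewrite /= indicE.
rewrite mulr1.
have P01 u : 0 <= ((u \in P)%:R : R) <= 1.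
  by case: (u \in P); rewrite ?lexx ?ler01.
have := hT h hH 1 (fun u => (u \in P)%:R) P01 y.
have : \sum_(t <- T) (t + (h + y) \in P)%:R
    <= \sum_(t <- T) translate (t + y) (linf_indic R F) (h + z).
  rewrite big_seq [leRHS]big_seq; apply: ler_sum => t tT.
  rewrite /= indicE ler_nat.
  case: (boolP (t + (h + y) \in P)) => // tP; rewrite (_ : _ \in F)//.
  apply/mem_set; exists (t + (h + y)); last first.
    by exists z => //; rewrite -!addrA; congr (_ + _); rewrite addrCA.
  by rewrite /= mem_filter tP; apply/allpairsP; exists (t, h).
rewrite ler_norml; lra.
Qed.

End Thickness.

(** * Splitting an invariant mean along a set *)

Section Components.
Context {R : realType} {G : zmodType} (L : {linear linf R G -> R^o}).
Hypothesis L_inv : invariant_means L.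
Local Notation mu := (mean_set L).
Implicit Types (X Y Z A B E : set G) (g : G) (f : linf R G).

Lemma restr_linf E f : (fun x => \1_E x * f x) \in @linf_pred R G.
Proof.
have /linf_predP[M fM] := linf_valP f; apply/linf_predP; exists M => x.
rewrite indicE; case: (x \in E); rewrite ?mul1r ?mul0r//.
by rewrite normr0 (le_trans _ (fM x)).
Qed.

Definition restr E f : linf R G := Linf (restr_linf E f).

Lemma localize_linf E f : (fun g => L (restr E (translate g f))) \in @linf_pred R G.
Proof.
have [M M0 fM] := linf_bounded f; apply/linf_predP; exists M => g.
have LM : L (M *: linf_indic R setT) = M.
  by rewrite linearZ -[L _]/(mu setT) (meanT L_inv) -[LHS]/(M * 1) mulr1.
have bd x : `|restr E (translate g f) x| <= M.
  rewrite /= indicE; case: (x \in E); rewrite ?mul1r ?mul0r//.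
  by rewrite normr0.
rewrite ler_norml -LM -linearN; apply/andP; split;
  apply: (functional_le (mean_positive L_inv)) => x;
  have := bd x; rewrite ler_norml => /andP[? ?].
  by rewrite -scaleNr linfZ linf_indicE in_setT mulr1.
by rewrite linfZ linf_indicE in_setT mulr1.
Qed.

Definition localize E f : linf R G := Linf (localize_linf E f).

(** Averaging g |-> L (1_E * f (g + .)) by L itself gives an invariant functional
of total mass L E.  When L is a mixture of ergodic means, it reweights each of
them by its measure of E. *)
Definition component E f : R^o := L (localize E f).

Lemma component_linear E : linear (component E).
Proof.
move=> a f f'; rewrite /component -linearP; congr (L _); apply: linf_ext => g.
rewrite linfD linfZ /= -[a * _]/(a *: (_ : R^o)) -linearP; congr (L _).
by apply: linf_ext => x; rewrite linfD linfZ /= mulrDr mulrCA.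
Qed.

HB.instance Definition _ E :=
  GRing.isLinear.Build R (linf R G) R^o _ (component E) (component_linear E).

Lemma component_ge0 E : positive_functional (component E).
Proof.
move=> f f0; apply: (mean_positive L_inv) => g; apply: (mean_positive L_inv) => x.
by rewrite /= indicE mulr_ge0.
Qed.

Lemma component_translate E g f : component E (translate g f) = component E f.
Proof.
rewrite /component -[RHS](mean_translate L_inv g); congr (L _).
apply: linf_ext => h /=; congr (L _); apply: linf_ext => x /=.
by rewrite addrA.
Qed.

Lemma component_indicE E X g :
  localize E (linf_indic R X) g = mu (translate_set (- g) X `&` E).
Proof.
rewrite /= /mean_set; congr (L _); apply: linf_ext => x.
rewrite linf_indicE /= !indicE in_setI mulrC -natrM mulnb.
congr (nat_of_bool (_ && _))%:R.
by apply/idP/idP => /set_mem /=; rewrite /translate_set/= ?opprK => ?;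
  apply/mem_set; rewrite /translate_set/= ?opprK addrC.
Qed.

Lemma componentT E : component E (linf_indic R setT) = mu E.
Proof.
rewrite /component (mean_set_setT (c := mu E)) ?(meanT L_inv) ?mulr1// => g.
by rewrite component_indicE (_ : translate_set _ _ `&` _ = E)//; apply/seteqP; split=> // x [].
Qed.

Lemma component_split E f : component E f + component (~` E) f = L f.
Proof.
rewrite /component -linearD -[RHS]mulr1 -(meanT L_inv); apply: mean_set_setT => g.
rewrite linfD /= -linearD -[RHS](mean_translate L_inv g); congr (L _).
apply: linf_ext => x; rewrite linfD /= -mulrDl !indicE in_setC.
by case: (x \in E); rewrite ?addr0 ?add0r mul1r.
Qed.

(** When L E = 0 the component vanishes, and any invariant mean will do. *)
Lemma component_mean E : exists L' : {linear linf R G -> R^o},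
  invariant_means L' /\ forall f, component E f = mu E * L' f.
Proof.
have [E0|E0] := eqVneq (mu E) 0.
  have le0 f : component E f <= 0.
    have [M M0 fM] := linf_bounded f.
    have <- : component E (M *: linf_indic R setT) = 0.
      by rewrite linearZ /= componentT E0 scaler0.
    apply: (functional_le (@component_ge0 E)) => x.
    by rewrite linfZ linf_indicE in_setT mulr1 (le_trans (ler_norm _)).
  exists L; split=> // f; rewrite E0 mul0r; apply/eqP; rewrite eq_le le0/=.
  by rewrite -oppr_le0 -linearN le0.
pose L' : {linear linf R G -> R^o} := (mu E)^-1 \*: component E.
have L'E f : L' f = (mu E)^-1 * component E f by [].
exists L'; split=> [|f]; last by rewrite L'E mulrA divff// mul1r.
apply: invariant_meanP.
- by move=> f f0; rewrite L'E mulr_ge0 ?invr_ge0 ?(mean_ge0 L_inv)//; exact: component_ge0.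
- by rewrite /mean_set L'E componentT mulVf.
- by move=> g f; rewrite !L'E component_translate.
Qed.

(** If no translate of X leaves E by much, the component along the complement of
E hardly sees X. *)
Lemma mean_split E : exists L1 L2 : {linear linf R G -> R^o},
  [/\ invariant_means L1, invariant_means L2,
     forall X, mu X = mu E * mean_set L1 X + (1 - mu E) * mean_set L2 X
   & forall X c, (forall g, mu (translate_set g X `\` E) <= c) ->
       (1 - mu E) * mean_set L2 X <= c].
Proof.
have [L1 [L1_inv L1E]] := component_mean E.
have [L2 [L2_inv L2E]] := component_mean (~` E).
have muC : mu (~` E) = 1 - mu E by rewrite -setTD meanD// meanT.
exists L1, L2; split=> // [X|X c hc].
  by rewrite -muC /mean_set -L1E -L2E component_split.
rewrite -muC /mean_set -L2E /component -[leRHS]mulr1 -(meanT L_inv).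
rewrite -[leRHS]/(c *: (_ : R^o)) -linearZ.
apply: (functional_le (mean_positive L_inv)) => g.
by rewrite component_indicE linfZ linf_indicE in_setT mulr1 -setDE.
Qed.

End Components.

(** * Cauchy families of almost minimizers *)

Section Minimizers.
Context {R : realType} {G : zmodType} {L : {linear linf R G -> R^o}}.
Hypothesis L_inv : invariant_means L.
Local Notation mu := (mean_set L).
Implicit Types (X Y Z A B : set G) (F : seq G) (g : G).

Lemma excess_submodular A (kappa : R) X Y :
  (mu (sumset A (X `|` Y)) - kappa * mu (X `|` Y))
    + (mu (sumset A (X `&` Y)) - kappa * mu (X `&` Y))
  <= (mu (sumset A X) - kappa * mu X) + (mu (sumset A Y) - kappa * mu Y).
Proof.
have e1 := meanUI (L := L) X Y.
have e2 := meanUI (L := L) (sumset A X) (sumset A Y).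
have e3 : mu (sumset A (X `&` Y)) <= mu (sumset A X `&` sumset A Y).
  by apply: (mean_le L_inv); rewrite subsetI; split; apply: sumsetS => // ? [].
have e4 : kappa * (mu (X `|` Y) + mu (X `&` Y)) = kappa * (mu X + mu Y) by rewrite e1.
rewrite sumsetUr; lra.
Qed.

(** [Q eta] plays the role of a tail of a Cauchy sequence of sets.  As L is only
finitely additive, such a sequence may have no limit set. *)
Definition cauchy_family (Q : R -> set (set G)) :=
  [/\ forall eta, 0 < eta -> exists Z, Q eta Z,
      forall eta eta', eta <= eta' -> Q eta `<=` Q eta'
    & forall e, 0 < e -> exists2 eta, 0 < eta &
        forall X Y, Q eta X -> Q eta Y -> mu (X `\` Y) <= e].

(** If X and Y both almost attain the infimum I of the functional, then by
submodularity so does their union.  Hence if L X and L Y are also almost as large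
as possible among almost minimizers, L of the union exceeds neither by much, and
X and Y are close. *)
Lemma cauchy_minimizers A B (kappa : R) : 0 <= kappa ->
  exists2 Q, cauchy_family Q & forall eta Z, Q eta Z ->
    Z `<=` B /\ forall Z', Z' `<=` B ->
      mu (sumset A Z) - kappa * mu Z <= mu (sumset A Z') - kappa * mu Z' + eta.
Proof.
move=> kappa0; pose phi Z := mu (sumset A Z) - kappa * mu Z.
pose V := [set phi Z | Z in [set Z | Z `<=` B]].
have V0 : V !=set0 by exists (phi B), B => /=.
have lbV : has_lbound V.
  exists (- kappa) => _ [Z _ <-]; rewrite /phi.
  have := mean_ge0 L_inv (sumset A Z).
  have := ler_wpM2l kappa0 (mean_le1 L_inv Z); lra.
pose I := inf V.
have I_le Z : Z `<=` B -> I <= phi Z by move=> ZB; apply: ge_inf => //; exists Z.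
pose U eta := [set mu Z | Z in [set Z | Z `<=` B /\ phi Z <= I + eta]].
have U0 eta : 0 < eta -> U eta !=set0.
  move=> eta0; have [_ [Z /= ZB <-] Zeta] := inf_adherent eta0 (conj V0 lbV).
  by exists (mu Z), Z => //; split=> //; exact: ltW.
have ubU eta : has_ubound (U eta).
  by exists 1 => _ [Z _ <-]; exact: mean_le1.
(* inf S is the limit, as eta goes to 0, of the largest measure of a set that is
   minimizing up to eta. *)
pose S := [set sup (U eta) | eta in [set eta | 0 < eta]].
have S0 : S !=set0 by exists (sup (U 1)), 1 => //=; exact: ltr01.
have lbS : has_lbound S.
  exists 0 => _ [eta /= eta0 <-]; have [x Ux] := U0 _ eta0.
  apply: le_trans (ub_le_sup (ubU eta) Ux).
  by case: Ux => Z _ <-; exact: mean_ge0.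
pose Q eta := [set Z | [/\ Z `<=` B, phi Z <= I + eta & inf S - eta <= mu Z]].
exists Q; last first.
  move=> eta Z [ZB Zphi _]; split=> // Z' Z'B.
  by rewrite -/(phi Z) -/(phi Z'); have := I_le _ Z'B; lra.
split.
- move=> eta eta0.
  have [_ [Z [/= ZB Zphi] <-] Zmu] := sup_adherent eta0 (conj (U0 _ eta0) (ubU eta)).
  exists Z; split=> //; apply/ltW; apply: le_lt_trans Zmu.
  by rewrite lerD2r; apply: ge_inf => //; exists eta.
- move=> eta eta' ee' Z [ZB Zphi Zmu]; split=> //; lra.
- move=> e e0; have e20 : 0 < e / 2 by rewrite divr_gt0.
  have [_ [eta1 /= eta10 <-] Heta1] := inf_adherent e20 (conj S0 lbS).
  exists (Num.min (eta1 / 2) (e / 2)); first by rewrite lt_min !divr_gt0.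
  set eta := Num.min _ _.
  have eta_1 : eta <= eta1 / 2 by rewrite ge_min lexx.
  have eta_e : eta <= e / 2 by rewrite ge_min lexx orbT.
  move=> X Y [XB Xphi Xmu] [YB Yphi Ymu].
  have XYB : X `&` Y `<=` B by move=> x [/XB].
  have XUYB : X `|` Y `<=` B by rewrite subUset.
  have I1 := I_le _ XYB.
  have I2 : phi (X `|` Y) + phi (X `&` Y) <= phi X + phi Y by exact: excess_submodular.
  have : mu (X `|` Y) <= sup (U eta1).
    apply: ub_le_sup => //; exists (X `|` Y) => //; split=> //; lra.
  have : mu (X `\` Y) = mu (X `|` Y) - mu Y.
    rewrite -(meanD (L := L)); last exact: subsetUr.
    by rewrite setDUl setDv setU0.
  lra.
Qed.

(** Choose F such that L (F + Z) is almost s, the largest limiting value along Q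
over all finite sets.  For any g, the list g :: F cannot beat s uniformly, so
L (g :: F + Z') < s + tau / 3 for some good Z'; by the Cauchy property,
L (g :: F + Z) < s + 2 tau / 3 for every good Z, which bounds what g + Z adds to
F + Z.  The point is that F is common to all good Z. *)
Lemma saturation Q (tau : R) : cauchy_family Q -> 0 < tau ->
  exists F eta, 0 < eta /\ forall Z, Q eta Z ->
    forall g, mu (translate_set g Z `\` sumset [set` F] Z) <= tau.
Proof.
move=> [Q0 Qmono Qc] tau0; have tau30 : 0 < tau / 3 by rewrite divr_gt0.
pose V := [set r | exists F eta, 0 < eta /\
  forall Z, Q eta Z -> r <= mu (sumset [set` F] Z)].
have V0 : V !=set0.
  by exists 0, [::], 1; split=> // Z _; exact: mean_ge0.
have ubV : has_ubound V.
  exists 1 => r [F [eta [eta0 hr]]]; have [Z QZ] := Q0 _ eta0.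
  exact: le_trans (hr _ QZ) (mean_le1 L_inv _).
have [r [F [eta [eta0 hr]]] rV] := sup_adherent tau30 (conj V0 ubV).
have n0 : 0 < (size F).+1%:R :> R by rewrite ltr0n.
have [eta2 eta20 heta2] := Qc _ (divr_gt0 tau30 n0).
exists F, (Num.min eta eta2); split; first by rewrite lt_min eta0.
move=> Z QZ g; set E := sumset _ Z.
have [Z' QZ' Z'lt] : exists2 Z', Q (Num.min eta eta2) Z'
    & mu (sumset [set` g :: F] Z') < sup V + tau / 3.
  apply: contrapT => /forall2NP hZ'.
  suff : sup V + tau / 3 <= sup V by lra.
  apply: ub_le_sup => //; exists (g :: F), (Num.min eta eta2).
  split=> [|Y QY]; first by rewrite lt_min eta0.
  by have [/(_ QY)//|/negP] := hZ' Y; rewrite -leNgt.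
have close : mu (Z `\` Z') <= tau / 3 / (size F).+1%:R.
  by apply: heta2; [apply: Qmono QZ | apply: Qmono QZ']; rewrite ge_min lexx orbT.
have := mean_sumset_seq_diff L_inv (g :: F) Z Z'.
have : (size (g :: F))%:R * mu (Z `\` Z') <= tau / 3.
  by rewrite mulrC -ler_pdivlMr.
have : r <= mu E by apply: hr; apply: Qmono QZ; rewrite ge_min lexx.
have -> : mu (translate_set g Z `\` E) = mu (sumset [set` g :: F] Z) - mu E.
  rewrite -(meanD (L := L)) sumset_cons; last exact: subsetUr.
  by rewrite setDUl setDv setU0.
lra.
Qed.

End Minimizers.

(** * Optimizing the mean and the minimizer together *)

Section Extremal.
Context {R : realType} {G : zmodType}.
Implicit Types (X Y Z A B : set G) (F : seq G) (g : G).
Implicit Types L m : {linear linf R G -> R^o}.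

(** The functional Phi below, minimized over all pairs (L, Z), has a strictly
negative infimum - w, because of L1 and B.  Near the infimum, L is nearly carried
by F + Z: in the splitting of L along E = F + Z, the component along E has Phi at
least - w, and the other one nearly nonnegative Phi since it does not see Z, so
that - w is only approached when L E is close to 1.  The bound on the penalty
M * (L (A + B) - delta) comes from Phi <= 0. *)
Lemma plunnecke_mean A B (kappa M delta : R) L1 m k (eps : R) :
  0 < kappa -> 0 <= M ->
  (forall L, invariant_means L -> delta <= mean_set L (sumset A B)) ->
  invariant_means L1 ->
  mean_set L1 (sumset A B) - kappa * mean_set L1 B
    + M * (mean_set L1 (sumset A B) - delta) < 0 ->
  invariant_means m -> (0 < k)%N -> 0 < eps ->
  exists L, [/\ invariant_means L, M * (mean_set L (sumset A B) - delta) <= kappa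
    & mean_set m (iter_sumset A k) <= kappa ^+ k * mean_set L B + eps].
Proof.
move=> kappa0 M0 hdelta L1_inv L1_neg m_inv k0 eps0.
set alpha := mean_set m _.
pose Phi L Z := mean_set L (sumset A Z) - kappa * mean_set L Z
  + M * (mean_set L (sumset A B) - delta).
pose V := [set r | exists L Z, [/\ invariant_means L, Z `<=` B & r = Phi L Z]].
have V0 : V !=set0 by exists (Phi L1 B), L1, B; split.
have Phi_ge L Z : invariant_means L -> - (kappa * mean_set L Z) <= Phi L Z.
  move=> L_inv; rewrite /Phi.
  have := mean_ge0 L_inv (sumset A Z).
  have : 0 <= M * (mean_set L (sumset A B) - delta).
    by rewrite mulr_ge0// subr_ge0 hdelta.
  lra.
have kappa_mean L Z : invariant_means L -> kappa * mean_set L Z <= kappa.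
  by move=> L_inv; apply: ler_piMr; [exact: ltW | exact: mean_le1].
have lbV : has_lbound V.
  exists (- kappa) => _ [L [Z [L_inv _ ->]]]; apply: le_trans (Phi_ge _ _ L_inv).
  by rewrite lerN2 kappa_mean.
pose w := - inf V.
have Phi_inf L Z : invariant_means L -> Z `<=` B -> - w <= Phi L Z.
  by move=> L_inv ZB; rewrite opprK; apply: ge_inf => //; exists L, Z.
have w0 : 0 < w by have := Phi_inf L1 B L1_inv (@subset_refl _ _); rewrite /Phi; lra.
pose e := Num.min (eps / 3) 1.
have e0 : 0 < e by rewrite lt_min divr_gt0//= ltr01.
have e1 : e <= 1 by rewrite ge_min lexx orbT.
have e3 : e <= eps / 3 by rewrite ge_min lexx.
have ew0 : 0 < e * w / 3 by rewrite divr_gt0// mulr_gt0.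
(* L is nearly optimal up to e * w / 3; Z0 is then traded for a better minimizer
   for the same L. *)
have [_ [L [Z0 [L_inv Z0B ->]]] Z0lt] := inf_adherent ew0 (conj V0 lbV).
rewrite -[inf V]opprK -/w in Z0lt.
have ew : e * w <= w by rewrite ler_piMl// ltW.
exists L; split=> //.
  have : Phi L Z0 <= 0 by lra.
  have := kappa_mean L Z0 L_inv; have := mean_ge0 L_inv (sumset A Z0).
  rewrite /Phi; lra.
have [Q Qc Qmin] := cauchy_minimizers L_inv A B (ltW kappa0).
have [F [eta1 [eta10 hF]]] := saturation L_inv Qc (divr_gt0 ew0 kappa0).
have [D [DA hD]] := thick_finite_subset (iter_sumset A k) F m_inv e0.
have [C [CA DC]] := seq_in_iter_sumset k0 DA.
have [N hN] := petridis_iter L_inv k (ltW kappa0) CA.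
have N0 : 0 < `|N| + 1 by rewrite ltr_wpDl.
(* F, D, C and N are now fixed; only then is the quality eta of Z chosen. *)
pose eta := Num.min eta1 (Num.min (e * w / 3) (e / (`|N| + 1))).
have eta0 : 0 < eta by rewrite !lt_min eta10 ew0 divr_gt0.
have eta_1 : eta <= eta1 by rewrite ge_min lexx.
have eta_w : eta <= e * w / 3 by rewrite !ge_min lexx orbT.
have eta_N : eta <= e / (`|N| + 1) by rewrite !ge_min lexx !orbT.
have [Qex Qmono _] := Qc; have [Z QZ] := Qex _ eta0.
have [ZB Zmin] := Qmin _ _ QZ.
have E1 := mean_le1 L_inv (sumset [set` F] Z).
have E0 := mean_ge0 L_inv (sumset [set` F] Z).
have hDZ := hD L L_inv Z; rewrite -/alpha in hDZ.
have Zsmall := hF Z (Qmono _ _ eta_1 _ QZ).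
have [La [Lb [La_inv Lb_inv Lsplit /(_ _ _ Zsmall) Lb_Z]]] :=
  mean_split L_inv (sumset [set` F] Z).
move: (mean_set L _) E0 E1 hDZ Lsplit Lb_Z => t t0 t1 hDZ Lsplit Lb_Z.
have E_large : 1 - t <= e.
  have ZL : Phi L Z <= - w + e * w / 3 + e * w / 3.
    by have := Zmin _ Z0B; rewrite /Phi in Z0lt *; lra.
  (* Phi is affine in L. *)
  have Phi_split : Phi L Z = t * Phi La Z
      + (1 - t) * Phi Lb Z.
    by rewrite /Phi (Lsplit Z) (Lsplit (sumset A Z)) (Lsplit (sumset A B)); ring.
  rewrite ler_pdivlMr// in Lb_Z.
  have La_ge := ler_wpM2l t0 (Phi_inf _ _ La_inv ZB).
  have s0 : 0 <= 1 - t by rewrite subr_ge0.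
  have Lb_ge := ler_wpM2l s0 (Phi_ge _ Z Lb_inv).
  rewrite -(ler_pM2r w0); lra.
have Nsmall : N * eta <= e.
  apply: le_trans (ler_wpM2r (ltW eta0) (_ : _ <= `|N| + 1)) _.
    by rewrite (le_trans (ler_norm _))// lerDl.
  by rewrite mulrC -ler_pdivlMr.
have D_le : mean_set L (sumset [set` D] Z) <= kappa ^+ k * mean_set L Z + N * eta.
  apply: le_trans (mean_le L_inv (sumsetS DC (@subset_refl _ _))) (hN _ _ _).
  by move=> Z' Z'Z; apply: Zmin; exact: subset_trans ZB.
have ZleB : kappa ^+ k * mean_set L Z <= kappa ^+ k * mean_set L B.
  by rewrite ler_wpM2l ?exprn_ge0 ?(ltW kappa0)//; exact: mean_le.
have : (alpha - e) * (1 - t)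
    <= 1 - t.
  rewrite ler_piMl ?subr_ge0//.
  by have := mean_le1 m_inv (iter_sumset A k); rewrite -/alpha; lra.
lra.
Qed.

End Extremal.

(** * From means to Banach densities *)

Section Densities.
Context {R : realType} {G : zmodType}.
Implicit Types (A B C : set G).
Implicit Types L m : {linear linf R G -> R^o}.

Lemma lower_density_le C L : invariant_means L -> lower_density R C <= mean_set L C.
Proof.
move=> L_inv; apply: ge_inf; last by exists L.
by exists 0 => _ [L' L'_inv <-]; exact: mean_ge0.
Qed.

Lemma le_upper_density C L : invariant_means L -> mean_set L C <= upper_density R C.
Proof.
move=> L_inv; apply: ub_le_sup; last by exists L.
by exists 1 => _ [L' L'_inv <-]; exact: mean_le1.
Qed.

Lemma upper_density_le C (c : R) : 0 <= c ->
  (forall L, invariant_means L -> mean_set L C <= c) -> upper_density R C <= c.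
Proof.
move=> c0 hc.
have [E0|/set0P E0] := eqVneq [set mean_set L C | L in @invariant_means R G] set0.
  by rewrite /upper_density E0 sup0.
by apply: ge_sup => // _ [L L_inv <-]; exact: hc.
Qed.

Lemma upper_density_ge0 C : 0 <= upper_density R C.
Proof.
have [E0|/set0P[_ [L L_inv _]]] := eqVneq [set mean_set L C | L in @invariant_means R G] set0.
  by rewrite /upper_density E0 sup0.
by apply: le_trans (le_upper_density C L_inv); exact: mean_ge0.
Qed.

Lemma lower_density_ge0 C : 0 <= lower_density R C.
Proof.
have [E0|/set0P E0] := eqVneq [set mean_set L C | L in @invariant_means R G] set0.
  by rewrite /lower_density E0 inf0.
by apply: lb_le_inf => // _ [L L_inv <-]; exact: mean_ge0.
Qed.

Lemma exists_mean_of_lower_density C : 0 < lower_density R C ->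
  [set mean_set L C | L in @invariant_means R G] !=set0.
Proof.
move=> C0; apply/set0P; apply: contraTneq C0 => C0.
by rewrite /lower_density C0 inf0 ltxx.
Qed.

(** Means of two kinds are compared: those that nearly minimize L (A + B), with
largest possible L B, whose limiting value is b; and the mean L provided by
[plunnecke_mean].  The penalty coefficient kappa / e1 forces the latter to satisfy
L (A + B) <= delta + e1, whence L B <= b + e. *)
Lemma plunnecke_density A B m k :
  0 < lower_density R B -> invariant_means m -> (0 < k)%N ->
  mean_set m (iter_sumset A k) * lower_density R B ^+ k.-1
    <= lower_density R (sumset A B) ^+ k.
Proof.
move=> beta0 m_inv k0; set beta := lower_density R B in beta0 *.
set delta := lower_density R (sumset A B).
set alpha := mean_set m _.
have alpha0 : 0 <= alpha by exact: mean_ge0.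
have delta0 : 0 <= delta by exact: lower_density_ge0.
have delta_le L : invariant_means L -> delta <= mean_set L (sumset A B).
  exact: lower_density_le.
pose U (e : R) := [set mean_set L B | L in
  [set L | invariant_means L /\ mean_set L (sumset A B) <= delta + e]].
have U0 e : 0 < e -> U e !=set0.
  move=> e0; have hS : has_inf [set mean_set L (sumset A B) | L in @invariant_means R G].
    split.
      have [_ [L L_inv _]] := exists_mean_of_lower_density beta0.
      by exists (mean_set L (sumset A B)), L.
    by exists 0 => _ [L L_inv <-]; exact: mean_ge0.
  have [_ [L L_inv <-] Llt] := inf_adherent e0 hS.
  by exists (mean_set L B), L => //; split=> //; exact: ltW.
have ubU e : has_ubound (U e) by exists 1 => _ [L [L_inv _] <-]; exact: mean_le1.
have beta_le e : 0 < e -> beta <= sup (U e).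
  move=> e0; have [x Ux] := U0 _ e0; apply: le_trans (ub_le_sup (ubU e) Ux).
  by case: Ux => L [L_inv _] <-; exact: lower_density_le.
pose V := [set sup (U e) | e in [set e | 0 < e]].
have V0 : V !=set0 by exists (sup (U 1)), 1 => //=; exact: ltr01.
have lbV : lbound V beta by move=> _ [e e0 <-]; exact: beta_le.
pose b := inf V.
have beta_b : beta <= b by exact: lb_le_inf.
have b0 : 0 < b by exact: lt_le_trans beta_b.
have b_le e : 0 < e -> b <= sup (U e).
  by move=> e0; apply: ge_inf; [exists beta | exists e].
have approx e : 0 < e -> alpha <= ((delta + e) / b) ^+ k * (b + e) + e.
  move=> e0.
  have [_ [e1 /= e10 <-] He1] := inf_adherent e0 (conj V0 (ex_intro _ _ lbV)).
  set kappa := (delta + e) / b.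
  have kappa0 : 0 < kappa by rewrite divr_gt0// ltr_wpDl.
  have M0 : 0 < kappa / e1 by rewrite divr_gt0.
  have n0 : 0 < 1 + kappa / e1 + kappa by rewrite !addr_gt0.
  (* Small enough for the pair (L1, B) to have a negative value. *)
  pose e2 := e / 2 / (1 + kappa / e1 + kappa).
  have e20 : 0 < e2 by rewrite !divr_gt0.
  have [_ [L1 [L1_inv L1S] <-] L1B] := sup_adherent e20 (conj (U0 _ e20) (ubU e2)).
  have := b_le _ e20 => b_e2.
  have L1_neg : mean_set L1 (sumset A B) - kappa * mean_set L1 B
      + kappa / e1 * (mean_set L1 (sumset A B) - delta) < 0.
    have h1 : kappa * (b - e2) <= kappa * mean_set L1 B.
      by rewrite ler_wpM2l ?(ltW kappa0)//; lra.
    have h2 : kappa / e1 * (mean_set L1 (sumset A B) - delta) <= kappa / e1 * e2.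
      by rewrite ler_wpM2l ?(ltW M0)//; lra.
    have h3 : kappa * b = delta + e by rewrite divfK// gt_eqF.
    have h4 : e2 * (1 + kappa / e1 + kappa) = e / 2 by rewrite divfK// gt_eqF.
    lra.
  have [L [L_inv LS Lalpha]] :=
    plunnecke_mean kappa0 (ltW M0) delta_le L1_inv L1_neg m_inv k0 e0.
  apply: le_trans Lalpha _; rewrite lerD2r ler_wpM2l ?exprn_ge0 ?(ltW kappa0)//.
  apply/ltW; apply: le_lt_trans He1; apply: ub_le_sup => //; exists L => //; split=> //.
  have : kappa / e1 * (mean_set L (sumset A B) - delta) <= kappa / e1 * e1.
    by rewrite divfK ?gt_eqF.
  by rewrite ler_pM2l// lerBlDl.
(* Let e tend to 0 in the polynomial inequality given by approx. *)
have limit : alpha * b ^+ k <= delta ^+ k * b.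
  pose p : {poly R} := (delta%:P + 'X) ^+ k * (b%:P + 'X) + (b ^+ k)%:P * 'X.
  have -> : delta ^+ k * b = p.[0] by rewrite /p !hornerE.
  apply: (cvgr_to_ge (F := 0^'+)).
    by apply: cvg_at_right_filter; exact: continuous_horner.
  near=> e; have e0 : 0 < e by near: e; exact: nbhs_right_gt.
  have bk0 : 0 < b ^+ k by exact: exprn_gt0.
  rewrite -[leRHS]/p.[e] /p !hornerE -ler_pdivlMr//.
  suff -> : ((delta + e) ^+ k * (b + e) + b ^+ k * e) / b ^+ k
      = ((delta + e) / b) ^+ k * (b + e) + e by exact: approx.
  by rewrite expr_div_n mulrDl [b ^+ k * e]mulrC mulfK ?gt_eqF// mulrAC.
apply: le_trans (ler_wpM2l alpha0 (_ : _ <= b ^+ k.-1)) _.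
  by rewrite lerXn2r// nnegrE ltW.
by rewrite -(ler_pM2r b0) -mulrA -exprSr prednK.
Unshelve. all: by end_near.
Qed.

Lemma plunnecke_upper_density A B k :
  0 < lower_density R B -> (0 < k)%N ->
  upper_density R (iter_sumset A k) * lower_density R B ^+ k.-1
    <= lower_density R (sumset A B) ^+ k.
Proof.
move=> B0 k0; have P0 : 0 < lower_density R B ^+ k.-1 by rewrite exprn_gt0.
rewrite -ler_pdivlMr//; apply: upper_density_le => [|L L_inv].
  by rewrite divr_ge0 ?exprn_ge0 ?lower_density_ge0.
by rewrite ler_pdivlMr//; exact: plunnecke_density.
Qed.

End Densities.

Unset Implicit Arguments.

Theorem corollary1p3 (R : realType) (G : zmodType) (hG : countable [set: G]) :
  (forall (A B : set G) (K : R),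
     0 < lower_density R B ->
     lower_density R (sumset A B) <= K * lower_density R B ->
     forall k : nat, (1 <= k)%N ->
       upper_density R (iter_sumset A k) <= K ^+ k * upper_density R B)
  /\
  (forall k : nat, (1 <= k)%N ->
   forall A B : set G,
     (k = 1%N -> 0 < lower_density R B) ->
     lower_density R (sumset A B) >=
       upper_density R (iter_sumset A k) `^ (k%:R^-1)
         * lower_density R B `^ (1 - k%:R^-1)).
Proof.
split=> [A B K B0 hK k k0|k k0 A B hB].
  have K0 : 0 <= K.
    by rewrite -(pmulr_lge0 _ B0); exact: le_trans (lower_density_ge0 _) hK.
  have [_ [L L_inv _]] := exists_mean_of_lower_density B0.
  apply: (@le_trans _ _ (K ^+ k * lower_density R B)); last first.
    rewrite ler_wpM2l ?exprn_ge0//.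
    exact: le_trans (lower_density_le B L_inv) (le_upper_density B L_inv).
  have P0 : 0 < lower_density R B ^+ k.-1 by rewrite exprn_gt0.
  rewrite -(ler_pM2r P0) -mulrA -exprS prednK// -exprMn.
  apply: le_trans (plunnecke_upper_density A B0 k0) _.
  by rewrite lerXn2r// nnegrE ?mulr_ge0 ?lower_density_ge0.
have kR : k%:R != 0 :> R by rewrite pnatr_eq0 -lt0n.
have [B0|B0] := eqVneq (lower_density R B) 0.
  have k1 : k != 1%N by apply: contra_eq_neq B0 => /hB /gt_eqF ->.
  rewrite B0 powR0 ?mulr0 ?lower_density_ge0//.
  by rewrite subr_eq0 eq_sym invr_eq1 pnatr_eq1.
have {hB}B_gt0 : 0 < lower_density R B by rewrite lt_neqAle eq_sym B0 lower_density_ge0.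
have -> : 1 - k%:R^-1 = k.-1%:R * k%:R^-1 :> R.
  by rewrite -subn1 natrB// mulrBl mul1r divff.
rewrite powRrM powR_mulrn ?lower_density_ge0// -powRM;
  rewrite ?exprn_ge0 ?lower_density_ge0 ?upper_density_ge0//.
have -> : lower_density R (sumset A B)
    = (lower_density R (sumset A B) ^+ k) `^ k%:R^-1.
  by rewrite -powR_mulrn ?lower_density_ge0// -powRrM divff// powRr1// lower_density_ge0.
apply: ge0_ler_powR; first by rewrite invr_ge0.
- by rewrite nnegrE mulr_ge0 ?exprn_ge0 ?lower_density_ge0 ?upper_density_ge0.
- by rewrite nnegrE exprn_ge0 ?lower_density_ge0.
- exact: plunnecke_upper_density.
Qed.
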